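(* Let $n\ge3$. An irreducible finite dimensional complex representation of $SL_n(\mathbb{Z})$ of depth $\ell$ has dimension at least $$\ell^{n-1}\cdot\prod_{p\mid\ell}\left(1-\frac1p\right)\ \ge\ \ell^{n-2},$$ where the product is over the primes $p$ dividing $\ell$.
   Context: For $\ell\ge1$ let $\Gamma_n(\ell)=\ker(SL_n(\mathbb{Z})\to SL_n(\mathbb{Z}/\ell\mathbb{Z}))$. The depth of a finite dimensional complex representation $\phi:SL_n(\mathbb{Z})\to GL(V)$ is the smallest $\ell\ge1$ such that there is an algebraic (rational) representation $\tilde\phi:SL_n(\mathbb{C})\to GL(V)$ with $\phi(g)=\tilde\phi(g)$ for all $g\in\Gamma_n(\ell)$ (such $\ell$ exists by superrigidity and the congruence subgroup property). *)

(* Defs.v *)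
From HB Require Import structures.
From mathcomp Require Import all_boot all_order all_algebra.
From mathcomp Require Import complex reals mpoly.

Set Implicit Arguments.
Unset Strict Implicit.
Unset Printing Implicit Defensive.

Import GRing.Theory.
Local Open Scope ring_scope.

Section SpecialLinear.
Variables (n : nat) (R : comNzRingType).

Record SL := MkSL { SLval :> 'M[R]_n; SLval_det : \det SLval == 1 }.

HB.instance Definition _ := [isSub for SLval].
HB.instance Definition _ := [Choice of SL by <:].

Fact SLone_subproof : \det (1%:M : 'M[R]_n) == 1.
Proof. by rewrite det1. Qed.

Fact SLmul_subproof (g h : SL) : \det (SLval g *m SLval h) == 1.
Proof. by rewrite det_mulmx !(eqP (SLval_det _)) mulr1. Qed.

Fact SLinv_subproof (g : SL) : \det (\adj (SLval g)) == 1.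
Proof.
have := congr1 determinant (mul_adj_mx (SLval g)).
by rewrite det_mulmx (eqP (SLval_det g)) mulr1 det1 => ->.
Qed.

Definition SLone : SL := MkSL SLone_subproof.
Definition SLmul (g h : SL) : SL := MkSL (SLmul_subproof g h).
Definition SLinv (g : SL) : SL := MkSL (SLinv_subproof g).

Fact SLmulA : associative SLmul.
Proof. by move=> g h k; apply: val_inj; rewrite /= mulmxA. Qed.

Fact SLmul1g : left_id SLone SLmul.
Proof. by move=> g; apply: val_inj; rewrite /= mul1mx. Qed.

Fact SLmulg1 : right_id SLone SLmul.
Proof. by move=> g; apply: val_inj; rewrite /= mulmx1. Qed.

Fact SLmulVg : left_inverse SLone SLinv SLmul.
Proof.
by move=> g; apply: val_inj; rewrite /= mul_adj_mx (eqP (SLval_det g)).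
Qed.

Fact SLmulgV : right_inverse SLone SLinv SLmul.
Proof.
by move=> g; apply: val_inj; rewrite /= mul_mx_adj (eqP (SLval_det g)).
Qed.

HB.instance Definition _ :=
  isGroup.Build SL SLmulA SLmul1g SLmulg1 SLmulVg SLmulgV.

End SpecialLinear.

Fact SLmap_subproof n (R S : comNzRingType) (f : {rmorphism R -> S})
  (g : SL n R) : \det (map_mx f (SLval g)) == 1.
Proof. by rewrite det_map_mx (eqP (SLval_det g)) rmorph1. Qed.

Definition SLmap n (R S : comNzRingType) (f : {rmorphism R -> S})
  (g : SL n R) : SL n S := MkSL (SLmap_subproof f g).

Section GeneralLinear.
Variables (K : fieldType) (V : vectType K).

Record GL := MkGL { GLend :> 'End(V); GLend_ker : lker GLend == 0%VS }.

HB.instance Definition _ := [isSub for GLend].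
HB.instance Definition _ := [Choice of GL by <:].

Fact GLone_subproof : lker (\1%VF : 'End(V)) == 0%VS.
Proof. by apply/lker0P => u v; rewrite !id_lfunE. Qed.

Fact GLmul_subproof (f g : GL) : lker (GLend f \o GLend g)%VF == 0%VS.
Proof.
apply/lker0P => u v; rewrite !comp_lfunE => eq_uv.
exact: (lker0P (GLend_ker g)) (lker0P (GLend_ker f) _ _ eq_uv).
Qed.

Fact GLinv_subproof (f : GL) : lker (GLend f)^-1%VF == 0%VS.
Proof.
apply/lker0P => u v /(congr1 (GLend f)).
by rewrite !lker0_lfunVK // GLend_ker.
Qed.

Definition GLone : GL := MkGL GLone_subproof.
Definition GLmul (f g : GL) : GL := MkGL (GLmul_subproof f g).
Definition GLinv (f : GL) : GL := MkGL (GLinv_subproof f).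

Fact GLmulA : associative GLmul.
Proof. by move=> f g h; apply: val_inj; rewrite /= comp_lfunA. Qed.

Fact GLmul1g : left_id GLone GLmul.
Proof. by move=> f; apply: val_inj; rewrite /= comp_lfun1l. Qed.

Fact GLmulg1 : right_id GLone GLmul.
Proof. by move=> f; apply: val_inj; rewrite /= comp_lfun1r. Qed.

Fact GLmulVg : left_inverse GLone GLinv GLmul.
Proof. by move=> f; apply: val_inj; rewrite /= lker0_compVf ?GLend_ker. Qed.

Fact GLmulgV : right_inverse GLone GLinv GLmul.
Proof. by move=> f; apply: val_inj; rewrite /= lker0_compfV ?GLend_ker. Qed.

HB.instance Definition _ :=
  isGroup.Build GL GLmulA GLmul1g GLmulg1 GLmulVg GLmulgV.

End GeneralLinear.

Definition irreducible_rep (G : groupType) (K : fieldType) (V : vectType K)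
    (phi : {multiplicative G -> GL V}) : Prop :=
  (0 < \dim {:V})%N /\
  forall U : {vspace V}, (forall g : G, (GLend (phi g) @: U <= U)%VS) ->
    U = 0%VS \/ U = fullv.

(* Every matrix coefficient g |-> f (psi g v) is a polynomial in the entries
   of g.  Since \det g = 1, these are all the regular functions on SL_n. *)
Definition algebraic_rep (n : nat) (K : fieldType) (V : vectType K)
    (psi : {multiplicative SL n K -> GL V}) : Prop :=
  forall (f : 'Hom(V, K^o)) (v : V), exists p : {mpoly K[n * n]},
    forall g : SL n K,
      f (GLend (psi g) v) = p.@[fun k => mxvec (SLval g) 0 k].

(* The kernel of reduction mod l, stated entrywise because 'Z_1 is not the
   zero ring in MathComp. *)
Definition principal_congruence (n l : nat) (g : SL n int) : Prop :=
  forall i j : 'I_n, (SLval g i j = (i == j)%:R %[mod l%:Z])%Z.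

Definition algebraic_on_congruence (n : nat) (K : fieldType) (V : vectType K)
    (phi : {multiplicative SL n int -> GL V}) (l : nat) : Prop :=
  exists psi : {multiplicative SL n K -> GL V},
    algebraic_rep psi /\
    forall g : SL n int, principal_congruence l g -> phi g = psi (SLmap intr g).

Definition has_depth (n : nat) (K : fieldType) (V : vectType K)
    (phi : {multiplicative SL n int -> GL V}) (l : nat) : Prop :=
  [/\ (0 < l)%N,
      algebraic_on_congruence phi l &
      forall m : nat, (0 < m)%N -> algebraic_on_congruence phi m -> (l <= m)%N].

(* Main.v *)
Require Import Defs.
From mathcomp Require Import all_boot all_order all_algebra.
From mathcomp Require Import complex reals mpoly.
From mathcomp Require Import boolp cyclic separable cyclotomic ring.

(** Let [phi] have depth [l], and let [psi] be an algebraic representation that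
    agrees with [phi] on the congruence subgroup Gamma(l).  As Gamma(l) is
    normal, [sg g = psi(g)^-1 phi(g)] commutes with [psi(Gamma(l))], hence with
    [psi(SL_n(Z))]: SL_n(Z) is generated by Gamma(l) and the elementary
    matrices e_ij(t), and commuting with [psi(e_ij(t))] is a polynomial
    condition on [t] that holds on the multiples of [l]
    ([untwist_psi_commute]).  So [sg] is a representation of SL_n(Z), trivial
    on Gamma(l), that commutes with [psi], and [phi = psi sg].

    For a prime [p] dividing [l], the vectors fixed by [sg(Gamma(l/p))] form a
    [phi]-stable subspace.  It is not the whole space, since [l] is the depth,
    so it is 0 by irreducibility ([untwist_fixed]).

    Now restrict [sg] to the abelian group N = (Z/l)^(n-1) of matrices that
    differ from 1 only in the first row; its characters are indexed by rows
    [c] in (Z/l)^(n-1).  Let [X] be the image of e_01(1).  The product over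
    the primes [p] of [l] of the operators [1 - X^(l/p)] is not 0
    ([primitive_part_neq0]): this is where the absence of vectors fixed by
    Gamma(l/p) enters, together with the generation of Gamma(l/p) modulo
    Gamma(l) by conjugates of e_01(l/p) ([pcong_generation],
    [normal_subgroup_root]).  Hence some character [c] occurring in [sg] has
    an invertible first coordinate ([occurs_unit]).  The block SL_(n-1)
    normalises N and permutes the characters that occur, and column operations
    turn [c] into any other row with invertible first coordinate
    ([occurs_unit_orbit]); these operations need [n - 1 >= 2].

    Eigenvectors for distinct characters are independent, so the dimension is
    at least [totient l * l ^ (n - 2)], the number of such rows, which is
    l^(n-1) times the product of the [1 - 1/p].  The second inequality only
    says that [totient l >= 1].

    The group theory rests on [elem_normal_generation]: over a ring of stable
    rank one, such as Z/l, elimination shows that matrices of determinant 1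
    congruent to 1 modulo [a] are products of conjugates of elementary
    matrices whose off-diagonal entry is divisible by [a]. *)

Set Implicit Arguments.
Unset Strict Implicit.
Unset Printing Implicit Defensive.

Import GRing.Theory Num.Theory.
Local Open Scope ring_scope.

(** * Elementary matrices *)

Section ElementaryMatrices.
Variable A : comNzRingType.

Definition elem_mx n (i j : 'I_n) (r : A) : 'M[A]_n := 1%:M + r *: delta_mx i j.
Definition upper_row m (t : 'rV[A]_m) : 'M[A]_(1 + m) := block_mx 1%:M t 0 1%:M.
Definition lower_col m (c : 'cV[A]_m) : 'M[A]_(1 + m) := block_mx 1%:M 0 c 1%:M.
Definition lower_block m (d : 'M[A]_m) : 'M[A]_(1 + m) := block_mx 1%:M 0 0 d.

Lemma elem_mxD n (i j : 'I_n) r s :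
  i != j -> elem_mx i j r *m elem_mx i j s = elem_mx i j (r + s).
Proof.
move=> neq_ij; rewrite /elem_mx mulmxDl !mulmxDr !mul1mx mulmx1.
rewrite -scalemxAl -scalemxAr mul_delta_mx_0 ?scaler0 ?addr0 1?eq_sym //.
by rewrite scalerDl addrA addrAC.
Qed.

Lemma elem_mx0 n (i j : 'I_n) : elem_mx i j 0 = 1%:M.
Proof. by rewrite /elem_mx scale0r addr0. Qed.

Lemma det_elem_mx n (i j : 'I_n) r : i != j -> \det (elem_mx i j r) = 1.
Proof.
have trig_case (k l : 'I_n) : (l < k)%N -> \det (elem_mx k l r) = 1.
  move=> lt_lk; rewrite det_trig.
    rewrite big1 // => m _; rewrite !mxE eqxx.
    case: eqP => [->|]; last by rewrite mulr0 addr0.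
    by rewrite -val_eqE gtn_eqF //= mulr0 addr0.
  apply/is_trig_mxP => p q lt_pq; rewrite !mxE -!val_eqE ltn_eqF //=.
  case: eqP => [eq_pk|]; last by rewrite mulr0 addr0.
  case: eqP => [eq_ql|]; last by rewrite mulr0 addr0.
  by move: lt_pq; rewrite eq_pk eq_ql ltnNge ltnW.
rewrite neq_ltn => /orP[lt_ij|]; last exact: trig_case.
rewrite -det_tr -(trig_case j i lt_ij); congr (\det _).
by rewrite /elem_mx linearD /= linearZ /= trmx1 trmx_delta.
Qed.

(** The Steinberg relation, grouped so that a normal subgroup containing one
    of the two factors visibly contains the right-hand side. *)
Lemma elem_mx_commutator n (i j k : 'I_n) r s : i != j -> j != k -> i != k ->
  elem_mx i j r *m (elem_mx j k s *m elem_mx i j (- r) *m elem_mx j k (- s))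
    = elem_mx i k (r * s).
Proof.
move=> ij jk ik.
have ji: j != i by rewrite eq_sym.
have kj: k != j by rewrite eq_sym.
have ki: k != i by rewrite eq_sym.
have aa : delta_mx i j *m delta_mx i j = 0 :> 'M[A]_n by rewrite mul_delta_mx_0.
have bb : delta_mx j k *m delta_mx j k = 0 :> 'M[A]_n by rewrite mul_delta_mx_0.
have ba : delta_mx j k *m delta_mx i j = 0 :> 'M[A]_n by rewrite mul_delta_mx_0.
rewrite /elem_mx -(mul_delta_mx j i k).
move: (delta_mx i j) (delta_mx j k) aa bb ba => a b aa bb ba.
have -> : (1%:M + s *: b) *m (1%:M + - r *: a) = 1%:M + s *: b - r *: a.
  rewrite mulmxDl mul1mx mulmxDr mulmx1 -!scalemxAl -!scalemxAr ba !scaler0.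
  by rewrite addr0 scaleNr addrAC.
have -> : (1%:M + s *: b - r *: a) *m (1%:M + - s *: b) =
          1%:M - r *: a + (r * s) *: (a *m b).
  rewrite mulmxDr mulmx1 -!scalemxAr !mulmxDl mulNmx mul1mx -!scalemxAl bb.
  rewrite scaler0 addr0 scalerDr scalerN !scaleNr opprK scalerA mulrC.
  by rewrite addrA [in LHS](addrAC 1%:M) addrK.
rewrite mulmxDl mul1mx mulmxDr mulmxBr mulmx1 -!(scalemxAl, scalemxAr).
by rewrite mulmxA aa mul0mx !scaler0 subr0 addr0 addrAC subrK.
Qed.

Lemma upper_rowD m (s t : 'rV[A]_m) :
  upper_row s *m upper_row t = upper_row (s + t).
Proof.
by rewrite mulmx_block !(mul1mx, mulmx1, mul0mx, mulmx0, addr0, add0r) addrC.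
Qed.

Lemma lower_colD m (s t : 'cV[A]_m) :
  lower_col s *m lower_col t = lower_col (s + t).
Proof.
by rewrite mulmx_block !(mul1mx, mulmx1, mul0mx, mulmx0, addr0, add0r).
Qed.

Lemma upper_row0 m : upper_row 0 = 1%:M :> 'M_(1 + m).
Proof. by rewrite /upper_row -scalar_mx_block. Qed.

Lemma lower_col0 m : lower_col 0 = 1%:M :> 'M_(1 + m).
Proof. by rewrite /lower_col -scalar_mx_block. Qed.

Lemma det_upper_row m (t : 'rV[A]_m) : \det (upper_row t) = 1.
Proof. by rewrite det_ublock !det1 mulr1. Qed.

Lemma det_lower_block m (d : 'M[A]_m) : \det (lower_block d) = \det d.
Proof. by rewrite det_ublock det1 mul1r. Qed.

Lemma lower_blockM m (d e : 'M[A]_m) :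
  lower_block d *m lower_block e = lower_block (d *m e).
Proof.
by rewrite mulmx_block !(mul1mx, mulmx1, mul0mx, mulmx0, addr0, add0r).
Qed.

Lemma lower_block1 m : lower_block 1%:M = 1%:M :> 'M_(1 + m).
Proof. by rewrite /lower_block -scalar_mx_block. Qed.

(** The block-diagonal copy of SL_m normalises the abelian group of the
    [upper_row t] and acts on it by right multiplication on [t]. *)
Lemma upper_row_conj m (d e : 'M[A]_m) (t : 'rV[A]_m) : d *m e = 1%:M ->
  lower_block d *m upper_row (t *m d) *m lower_block e = upper_row t.
Proof.
move=> de1; rewrite /lower_block /upper_row !mulmx_block.
by rewrite !(mul1mx, mulmx1, mul0mx, mulmx0, addr0, add0r) -mulmxA de1 mulmx1.
Qed.

Lemma upper_row_delta m (j : 'I_m) r :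
  upper_row (r *: delta_mx 0 j) = elem_mx (lshift m 0) (rshift 1 j) r.
Proof.
rewrite /elem_mx /upper_row [1%:M in RHS]scalar_mx_block.
apply/matrixP => a b; rewrite !mxE; case: splitP => a' ea; rewrite !mxE;
  case: splitP => b' eb; rewrite !mxE -!val_eqE /= ea eb ?ord1 //=;
  by rewrite ?andbF ?eqn_add2l ?mulr0 ?addr0 ?add0r.
Qed.

Lemma lower_col_delta m (j : 'I_m) r :
  lower_col (r *: delta_mx j 0) = elem_mx (rshift 1 j) (lshift m 0) r.
Proof.
apply: trmx_inj.
rewrite /lower_col tr_block_mx !trmx1 trmx0 linearZ /= trmx_delta.
rewrite [LHS]upper_row_delta /elem_mx linearD /= linearZ /=.
by rewrite trmx1 trmx_delta.
Qed.

Lemma lower_block_elem m (i j : 'I_m) r :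
  lower_block (elem_mx i j r) = elem_mx (rshift 1 i) (rshift 1 j) r.
Proof.
rewrite /lower_block /elem_mx [1%:M in RHS]scalar_mx_block.
apply/matrixP => a b; rewrite !mxE.
case: splitP => a' ea; rewrite !mxE; case: splitP => b' eb;
  rewrite !mxE -!val_eqE /= ea eb ?eqn_add2l ?ord1 //=;
  by rewrite ?andbF ?mulr0 ?addr0.
Qed.

End ElementaryMatrices.

(** * Relative generation by elementary matrices *)

Section RelativeGeneration.
Variable A : comUnitRingType.

Definition stable_rank_one :=
  forall x u y v : A, x * u + y * v = 1 -> exists z, x + y * z \is a GRing.unit.

(** Closure under conjugation is only asked for elementary matrices: this is
    inherited by the lower right block, and can be checked for the image of a
    subgroup of SL_n(Z) before SL_n(Z) is known to surject onto SL_n(A). *)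
Definition elem_normal n (a : A) (P : 'M[A]_n -> Prop) :=
  [/\ P 1%:M,
      forall x y, P x -> P y -> P (x *m y),
      forall i j r, i != j -> P (elem_mx i j (a * r)) &
      forall i j r x, i != j -> P x ->
        P (elem_mx i j r *m x *m elem_mx i j (- r))].

Lemma elem_normal_block m (a : A) (P : 'M[A]_(1 + m) -> Prop) :
  elem_normal a P -> elem_normal a (fun d => P (lower_block d)).
Proof.
case=> P1 PM PE PJ; split=> [|x y Px Py|i j r ij|i j r x ij Px].
- by rewrite lower_block1.
- by rewrite -lower_blockM; apply: PM.
- by rewrite lower_block_elem; apply: PE.
- rewrite -!lower_blockM !lower_block_elem; apply: PJ => //.
Qed.

Section Block.
Variables (m : nat) (a : A) (P : 'M[A]_(1 + m) -> Prop).
Hypothesis Pn : elem_normal a P.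

Lemma elem_normal_upper_row t : P (upper_row (a *: t)).
Proof.
case: Pn => P1 PM PE _; rewrite [t]row_sum_delta scaler_sumr.
apply: (big_ind (fun t => P (upper_row t))) => [|s t' Ps Pt|j _].
- by rewrite upper_row0.
- by rewrite -upper_rowD; apply: PM.
- by rewrite scalerA upper_row_delta; apply: PE; rewrite eq_lrshift.
Qed.

Lemma elem_normal_lower_col t : P (lower_col (a *: t)).
Proof.
case: Pn => P1 PM PE _; rewrite -[t]trmxK [t^T]row_sum_delta.
rewrite linear_sum scaler_sumr.
apply: (big_ind (fun t => P (lower_col t))) => [|s t' Ps Pt|j _].
- by rewrite lower_col0.
- by rewrite -lower_colD; apply: PM.
- rewrite linearZ /= trmx_delta scalerA lower_col_delta.
  by apply: PE; rewrite eq_rlshift.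
Qed.

Hypothesis P_block : forall d : 'M[A]_m,
  \det d = 1 -> (exists d', d = 1%:M + a *: d') -> P (lower_block d).

(** A corner equal to 1 can be cleared by block elimination, whose three
    factors are all congruent to 1 modulo [a]. *)
Lemma elem_normal_corner1 (b : 'rV_m) (c : 'cV_m) (d : 'M_m) :
    \det (block_mx 1%:M (a *: b) (a *: c) (1%:M + a *: d)) = 1 ->
  P (block_mx 1%:M (a *: b) (a *: c) (1%:M + a *: d)).
Proof.
case: Pn => P1 PM PE _ det1g.
have Eg : block_mx 1%:M (a *: b) (a *: c) (1%:M + a *: d) =
    lower_col (a *: c) *m lower_block (1%:M + a *: d - (a *: c) *m (a *: b))
      *m upper_row (a *: b).
  rewrite !mulmx_block !(mul1mx, mulmx1, mul0mx, mulmx0, addr0, add0r).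
  by congr block_mx; rewrite [RHS]addrC subrK.
rewrite Eg; apply: (PM _ _ _ (elem_normal_upper_row b)).
apply: (PM _ _ (elem_normal_lower_col c)); apply: P_block.
  move: det1g; rewrite Eg !det_mulmx det_upper_row mulr1 det_lower_block.
  by rewrite det_lblock !det1 !mul1r.
exists (d - a *: (c *m b)).
by rewrite -scalemxAl -scalemxAr -addrA -scalerBr.
Qed.

End Block.

Section Step.
Variables (m : nat) (a : A) (P : 'M[A]_(1 + m.+1) -> Prop).
Hypothesis Pn : elem_normal a P.
Hypothesis P_block : forall d : 'M[A]_m.+1,
  \det d = 1 -> (exists d', d = 1%:M + a *: d') -> P (lower_block d).

(** Once the corner [u = 1 + a x] is invertible, a lower column congruent to 0
    modulo [a] makes the entry below it [1 - u]; conjugation by the elementary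
    matrix that adds that row to the first one then turns the corner into 1. *)
Lemma elem_normal_unit_corner (x : A)
    (b : 'rV_m.+1) (c : 'cV_m.+1) (d : 'M_m.+1) :
    let g := block_mx (1 + a * x)%:M (a *: b) (a *: c) (1%:M + a *: d) in
  1 + a * x \is a GRing.unit -> \det g = 1 -> P g.
Proof.
set u := 1 + a * x => g Uu detg; case: (Pn) => P1 PM PE PJ.
pose e : 'cV[A]_m.+1 := delta_mx 0 0.
(* Adding [s] times the corner [u] to the column below leaves [(1 - u) e]. *)
pose s := - u^-1 *: (x *: e + c).
pose E r := upper_row (r *: delta_mx 0 0) : 'M[A]_(1 + m.+1).
pose d1 := d + a *: (s *m b).
have Eg1 : lower_col (a *: s) *m g =
    block_mx u%:M (a *: b) (- (a * x) *: e) (1%:M + a *: d1).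
  rewrite /g /lower_col mulmx_block !(mul1mx, mul0mx, addr0).
  congr block_mx.
    have us : u *: s = - (x *: e + c).
      by rewrite /s scalerA mulrN divrr // scaleN1r.
    rewrite mul_mx_scalar scalerA mulrC -scalerA us -scalerDr opprD.
    by rewrite subrK scalerN scalerA scaleNr.
  rewrite -scalemxAl -scalemxAr addrCA -scalerDr addrC [in RHS]addrC.
  by rewrite /d1 (addrC d).
have eE : (delta_mx 0 0 : 'rV[A]_m.+1) *m e = 1%:M.
  by rewrite mul_delta_mx; apply/matrixP => i j; rewrite !mxE !ord1.
have Eg2 : E 1 *m (lower_col (a *: s) *m g) *m E (- 1) =
    block_mx 1%:M (a *: (b + delta_mx 0 0 *m d1))
      (a *: (- x *: e)) (1%:M + a *: (d1 + x *: (e *m delta_mx 0 0))).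
  rewrite Eg1 /E /upper_row !mulmx_block.
  rewrite !(mul1mx, mulmx1, mul0mx, mulmx0, addr0, add0r).
  rewrite scale1r -scalemxAr eE.
  have -> : u%:M + - (a * x) *: 1%:M = 1%:M :> 'M_1.
    rewrite scale_scalar_mx mulr1 -raddfD /=.
    by congr (_%:M); rewrite /u; ring.
  rewrite mul1mx mulmxDr mulmx1 -scalemxAr; congr block_mx.
  - by rewrite scaleN1r scalerDr addrCA addKr.
  - by rewrite scalerA mulrN.
  - rewrite -!scalemxAl -!scalemxAr scaleN1r scalerN scaleNr opprK addrC.
    by rewrite -addrA -scalerA -scalerDr.
have P2 : P (E 1 *m (lower_col (a *: s) *m g) *m E (- 1)).
  rewrite Eg2; apply: elem_normal_corner1 => //.
  by rewrite -Eg2 !det_mulmx !det_upper_row det_lblock !det1 detg !mulr1.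
have EK r : E r *m E (- r) = 1%:M.
  by rewrite /E upper_rowD -scalerDl subrr scale0r upper_row0.
have -> : g = lower_col (a *: (- s)) *m
    (E (- 1) *m (E 1 *m (lower_col (a *: s) *m g) *m E (- 1)) *m E (- - 1)).
  rewrite -!mulmxA (mulmxA (E (-1)) (E 1)) EK mulmx1.
  have:= EK (- 1); rewrite opprK => ->.
  by rewrite mul1mx mulmxA lower_colD -scalerDr addNr scaler0 lower_col0 mul1mx.
apply: PM; first exact: elem_normal_lower_col.
by move: P2; rewrite /E !upper_row_delta; apply: PJ; rewrite eq_lrshift.
Qed.

Hypothesis sr1 : stable_rank_one.

(** Stable rank one makes the corner invertible.  The first row of the inverse
    gives [(1 + a x) r0 + a y = 1], where [a y] combines the entries below the
    corner; only [a]-multiples of these entries may be added, and the corner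
    [1 + a x] is still coprime to [a (a y)] because it is coprime to [a]. *)
Lemma elem_normal_step (g' : 'M[A]_(1 + m.+1)) :
  \det (1%:M + a *: g') = 1 -> P (1%:M + a *: g').
Proof.
move=> detg; case: (Pn) => P1 PM PE PJ.
set g := 1%:M + a *: g'.
pose x := ulsubmx g' 0 0; pose b := ursubmx g'; pose c := dlsubmx g'.
pose d := drsubmx g'.
have Eg : g = block_mx (1 + a * x)%:M (a *: b) (a *: c) (1%:M + a *: d).
  rewrite /g -[g' in LHS]submxK scale_block_mx [1%:M in LHS]scalar_mx_block.
  rewrite add_block_mx !add0r; congr block_mx.
  by rewrite [ulsubmx g']mx11_scalar scale_scalar_mx raddfD.
pose h := \adj g.
have : h *m g = 1%:M by rewrite mul_adj_mx detg.
rewrite -[h]submxK Eg mulmx_block (@scalar_mx_block _ 1 m.+1).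
case/eq_block_mx=> corner _ _ _.
pose r := ursubmx h; pose y := (r *m c) 0 0; pose r0 := ulsubmx h 0 0.
have {}corner : (1 + a * x) * r0 + a * y = 1.
  move: corner; rewrite mul_mx_scalar -scalemxAr -/r => /matrixP/(_ 0 0).
  by rewrite /r0 /y !mxE eqxx.
(* In the term [a y], replace the factor 1 by [(1 + a x) - a x]. *)
have /sr1[z Uz] : (1 + a * x) * (r0 + y * a) + (a * (a * y)) * (- x) = 1.
  rewrite -[RHS]corner; ring.
pose t := z *: r; rewrite -Eg.
have -> : g = upper_row (a *: - t) *m (upper_row (a *: t) *m g).
  by rewrite mulmxA upper_rowD -scalerDr addNr scaler0 upper_row0 mul1mx.
apply: PM; first exact: elem_normal_upper_row.
have Ec : upper_row (a *: t) *m g =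
    block_mx (1 + a * (x + a * y * z))%:M (a *: (b + t + a *: (t *m d)))
      (a *: c) (1%:M + a *: d).
  rewrite Eg mulmx_block !(mul1mx, mul0mx, add0r); congr block_mx.
    rewrite -scalemxAl -scalemxAr /t -scalemxAl [r *m c]mx11_scalar -/y.
    by rewrite !scale_scalar_mx -raddfD /=; congr _%:M; ring.
  rewrite mulmxDr mulmx1 -scalemxAl -scalemxAr !scalerDr.
  by rewrite addrA.
have detE : \det (upper_row (a *: t) *m g) = 1.
  by rewrite det_mulmx det_upper_row mul1r.
rewrite Ec in detE *; apply: elem_normal_unit_corner => //.
by congr (_ \is a _): Uz; ring.
Qed.

End Step.

(** Relative elementary generation of SL_n over a ring of stable rank one:
    elimination reduces the size of the matrix one row at a time, and the
    congruence modulo [a] is kept at each step. *)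
Theorem elem_normal_generation (sr1 : stable_rank_one) n (a : A)
    (P : 'M[A]_n -> Prop) (g' : 'M[A]_n) :
  elem_normal a P -> \det (1%:M + a *: g') = 1 -> P (1%:M + a *: g').
Proof.
elim: n => [|[|m] IHm] in P g' * => Pn.
- by case: Pn => P1 _ _ _ _; rewrite [_ + _]flatmx0 -[0](flatmx0 1%:M).
- case: Pn => P1 _ _ _ detg; suff -> : 1%:M + a *: g' = 1%:M by [].
  by rewrite [LHS]mx11_scalar -det_mx11 detg.
apply: (@elem_normal_step m a P) => // d detd [d' Ed].
by rewrite Ed in detd *; apply: IHm (@elem_normal_block m.+1 a P Pn) detd.
Qed.

End RelativeGeneration.

(** * Congruence subgroups of SL_n(Z) *)

Lemma coprime_from_primes (l m : nat) : (0 < l)%N ->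
  (forall p, prime p -> (p %| l)%N -> ~~ (p %| m)%N) -> coprime l m.
Proof.
move=> l_gt0 Hp; rewrite /coprime; apply: contraT => neq1.
have g_gt1 : (1 < gcdn l m)%N by rewrite ltn_neqAle eq_sym neq1 gcdn_gt0 l_gt0.
have := Hp _ (pdiv_prime g_gt1) (dvdn_trans (pdiv_dvd _) (dvdn_gcdl _ _)).
by rewrite (dvdn_trans (pdiv_dvd _) (dvdn_gcdr _ _)).
Qed.

(** Take for [z] the product of the primes of [l] that do not divide [x]: each
    prime of [l] then divides exactly one of [x] and [y * z]. *)
Lemma coprime_shift (l x y : nat) : (0 < l)%N ->
    (forall p, prime p -> (p %| l)%N -> (p %| x)%N -> ~~ (p %| y)%N) ->
  exists z, coprime l (x + y * z).
Proof.
move=> l_gt0 Hxy; exists (\prod_(p <- primes l | ~~ (p %| x)%N) p)%N.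
apply: coprime_from_primes => // p p_pr p_l; have [p_x|p_x] := boolP (p %| x)%N.
  rewrite dvdn_addr // Euclid_dvdM // negb_or Hxy //=.
  rewrite Euclid_dvd_prod // big_has_cond.
  apply/hasPn => q; rewrite mem_primes => /and3P[q_pr _ _] /=.
  apply/andP=> -[q_x]; rewrite dvdn_prime2 // => /eqP pq.
  by rewrite -pq p_x in q_x.
rewrite dvdn_addl // dvdn_mull // (big_rem p) ?mem_primes ?p_pr ?l_gt0 //=.
by rewrite p_x dvdn_mulr.
Qed.

Lemma Zp_stable_rank_one (l : nat) : (1 < l)%N -> stable_rank_one 'Z_l.
Proof.
move=> l_gt1 x u y v xyE.
have [|p p_pr p_l p_x|z coz] := @coprime_shift l x y; first exact: ltnW.
  apply/negP => p_y.
  have /(congr1 (@nat_of_ord _)) : (x * u + y * v)%:R = 1%:R :> 'Z_l.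
    by rewrite natrD !natrM !natr_Zp.
  rewrite !val_Zp_nat // (modn_small l_gt1) => E.
  have p_s : (p %| x * u + y * v)%N by rewrite dvdn_add // dvdn_mulr.
  move: p_s; rewrite (divn_eq (x * u + y * v) l) dvdn_addr; last exact: dvdn_mull.
  by rewrite E Euclid_dvd1.
by exists z%:R; rewrite -[x]natr_Zp -[y]natr_Zp -natrM -natrD unitZpE.
Qed.

Lemma intr_Zp_eq0 (l : nat) (m : int) : (1 < l)%N ->
  (m%:~R == 0 :> 'Z_l) = (l%:Z %| m)%Z.
Proof.
move=> l_gt1; have nat_case (k : nat) : (k%:R == 0 :> 'Z_l) = (l %| k)%N.
  by rewrite -val_eqE /= val_Zp_nat.
case: m => k; rewrite dvdzE /= -nat_case // NegzE.
by rewrite mulrNz oppr_eq0.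
Qed.

Section Congruence.
Variable n : nat.
Implicit Types (g h : SL n int) (l : nat).

Lemma SLval_inj (A : comNzRingType) : injective (@SLval n A).
Proof. exact: val_inj. Qed.

Lemma SLvalM (A : comNzRingType) (g h : SL n A) :
  SLval (g * h)%g = SLval g *m SLval h.
Proof. by []. Qed.

Lemma SLval1 (A : comNzRingType) : SLval (1%g : SL n A) = 1%:M.
Proof. by []. Qed.

Lemma SLdet (A : comNzRingType) (g : SL n A) : \det (SLval g) = 1.
Proof. exact/eqP/SLval_det. Qed.

Lemma pcongP l g : principal_congruence l g <->
  exists g' : 'M[int]_n, SLval g = 1%:M + l%:Z *: g'.
Proof.
split=> [gl|[g' Eg] i j].
  exists (\matrix_(i, j) ((SLval g i j - (i == j)%:R) %/ l%:Z)%Z).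
  apply/matrixP => i j; rewrite !mxE.
  have /divzK Ed : (l%:Z %| SLval g i j - (i == j)%:R)%Z.
    by rewrite -eqz_mod_dvd; apply/eqP/gl.
  by rewrite mulrC Ed addrC subrK.
by apply/eqP; rewrite eqz_mod_dvd Eg !mxE addrAC subrr add0r dvdz_mulr.
Qed.

Lemma pcong_map l g : (1 < l)%N ->
  map_mx intr (SLval g) = 1%:M :> 'M['Z_l]_n -> principal_congruence l g.
Proof.
move=> l_gt1 /matrixP Eg i j; apply/eqP; rewrite eqz_mod_dvd -intr_Zp_eq0 //.
move: (Eg i j); rewrite !mxE => Eij.
by rewrite rmorphB /= Eij mulrz_nat subrr.
Qed.

Lemma pcong1 l : principal_congruence l (1%g : SL n int).
Proof. by apply/pcongP; exists 0; rewrite scaler0 addr0. Qed.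

Lemma pcong_all g : principal_congruence 1 g.
Proof. by apply/pcongP; exists (SLval g - 1%:M); rewrite scale1r addrC subrK. Qed.

Lemma pcong_dvd l m g : (m %| l)%N ->
  principal_congruence l g -> principal_congruence m g.
Proof.
move=> /dvdnP[k ->] /pcongP[g' Eg]; apply/pcongP; exists (k%:Z *: g').
by rewrite Eg scalerA PoszM mulrC.
Qed.

Lemma pcongM l g h : principal_congruence l g -> principal_congruence l h ->
  principal_congruence l (g * h)%g.
Proof.
move=> /pcongP[g' Eg] /pcongP[h' Eh]; apply/pcongP.
exists (g' + h' + l%:Z *: (g' *m h')).
rewrite SLvalM Eg Eh mulmxDl mul1mx mulmxDr mulmx1 -!scalemxAl -scalemxAr.
by rewrite !scalerDr addrACA -!addrA; congr (_ + _); rewrite addrCA addrA.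
Qed.

Lemma pcongV l g : principal_congruence l g -> principal_congruence l g^-1%g.
Proof.
move=> /pcongP[g' Eg]; apply/pcongP; exists (- (g' *m SLval g^-1%g)).
have := congr1 (@SLval _ _) (mulgV g); rewrite SLvalM SLval1 {1}Eg mulmxDl mul1mx.
by move=> <-; rewrite scalerN -scalemxAl addrK.
Qed.

Lemma pcongJ l g h : principal_congruence l g ->
  principal_congruence l (h * g * h^-1)%g.
Proof.
move=> /pcongP[g' Eg]; apply/pcongP.
exists (SLval h *m g' *m SLval h^-1%g).
rewrite !SLvalM Eg mulmxDr mulmx1 mulmxDl -SLvalM mulgV SLval1.
by rewrite -scalemxAr -scalemxAl.
Qed.

(** The commutator of [1 + a g'] and [1 + b h'] is 1 modulo [a b], since
    [gh - hg = ab (g'h' - h'g')]. *)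
Lemma pcong_commute a b l g h : (l %| a * b)%N ->
    principal_congruence a g -> principal_congruence b h ->
  principal_congruence l (g * h * (h * g)^-1)%g.
Proof.
move=> l_ab /pcongP[g' Eg] /pcongP[h' Eh]; apply: (pcong_dvd l_ab).
apply/pcongP; exists ((g' *m h' - h' *m g') *m SLval (h * g)^-1%g).
rewrite -[1%:M](SLval1 int) -(mulgV (h * g)%g) !(SLvalM _ (_ * _)^-1%g).
rewrite scalemxAl -mulmxDl; congr (_ *m _).
rewrite !SLvalM Eg Eh !(mulmxDl, mulmxDr, mul1mx, mulmx1) -!scalemxAl -!scalemxAr.
rewrite !scalerA !scalerBr PoszM (mulrC b%:Z).
set x := a%:Z *: g'; set y := b%:Z *: h'; set z := _ *: _; set t := _ *: _.
by clearbody x y z t; apply/matrixP => i j; rewrite !mxE; ring.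
Qed.

End Congruence.

Definition normal_subgroup n (Q : SL n int -> Prop) :=
  [/\ Q 1%g, forall x y, Q x -> Q y -> Q (x * y)%g, forall x, Q x -> Q x^-1%g &
      forall g x, Q x -> Q (g * x * g^-1)%g].

(** A total function, so that elementary matrices can be written in SL_n without
    carrying proofs about their determinant. *)
Definition toSL n (A : comNzRingType) (M : 'M[A]_n) : SL n A :=
  insubd (1%g : SL n A) M.

Lemma toSLE n (A : comNzRingType) (M : 'M[A]_n) :
  \det M = 1 -> SLval (toSL M) = M.
Proof. by move=> detM; rewrite [LHS]val_insubd detM eqxx. Qed.

Definition elemSL n (A : comNzRingType) i j (r : A) : SL n A :=
  toSL (elem_mx i j r).

Lemma elemSLE n (A : comNzRingType) (i j : 'I_n) (r : A) :
  i != j -> SLval (elemSL i j r) = elem_mx i j r.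
Proof. by move=> ij; rewrite toSLE ?det_elem_mx. Qed.

Lemma elemSLD n (A : comNzRingType) (i j : 'I_n) (r s : A) :
  i != j -> elemSL i j (r + s) = (elemSL i j r * elemSL i j s)%g.
Proof. by move=> ij; apply: val_inj; rewrite /= !elemSLE // elem_mxD. Qed.

Lemma elemSLN n (A : comNzRingType) (i j : 'I_n) (r : A) :
  i != j -> elemSL i j (- r) = (elemSL i j r)^-1%g.
Proof.
move=> ij; apply/esym/mulg1_eq; rewrite -elemSLD // subrr.
by apply: val_inj; rewrite /= elemSLE // elem_mx0.
Qed.

Lemma map_elem_mx (A B : comNzRingType) (f : {rmorphism A -> B}) n
    (i j : 'I_n) r :
  map_mx f (elem_mx i j r) = elem_mx i j (f r).
Proof. by rewrite /elem_mx map_mxD map_mx1 map_mxZ map_delta_mx. Qed.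

Lemma pcong_elemSL n l (i j : 'I_n) (r : int) : i != j ->
  principal_congruence l (elemSL i j (l%:Z * r)).
Proof.
move=> ij; apply/pcongP; exists (r *: delta_mx i j).
by rewrite elemSLE // scalerA.
Qed.

(** [elem_normal_generation] for the image of [Q] in SL_n(Z/l); since [Q]
    contains the congruence subgroup of level [l], membership in [Q] can be
    tested on this image.  For [a = 1] it says that elementary matrices and
    the level [l] subgroup generate SL_n(Z). *)
Theorem pcong_generation n l a (Q : SL n int -> Prop) : (0 < l)%N ->
    normal_subgroup Q ->
    (forall i j (r : nat), i != j -> Q (elemSL i j (a%:Z * r%:Z))) ->
    (forall g, principal_congruence l g -> Q g) ->
  forall g, principal_congruence a g -> Q g.
Proof.
move=> l_gt0 [Q1 QM QV QJ] QE Ql g ga.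
have [l_gt1|] := ltnP 1 l; last first.
  case: l l_gt0 Ql => [|[]] // _ Ql _; apply/Ql/pcong_all.
pose P (M : 'M['Z_l]_n) := exists2 h, Q h & map_mx intr (SLval h) = M.
have Pn : elem_normal (a%:R : 'Z_l) P.
  split=> [|_ _ [x Qx <-] [y Qy <-]|i j r ij|i j r _ ij [x Qx <-]].
  - by exists 1%g; rewrite // SLval1 map_mx1.
  - by exists (x * y)%g; [exact: QM | rewrite SLvalM map_mxM].
  - exists (elemSL i j (a%:Z * (r : nat)%:Z)); first exact: QE.
    by rewrite elemSLE // map_elem_mx rmorphM /= -[in RHS](natr_Zp r).
  - exists (elemSL i j (r : nat)%:Z * x * (elemSL i j (r : nat)%:Z)^-1)%g.
      exact: QJ.
    rewrite -elemSLN // !SLvalM !map_mxM !elemSLE // !map_elem_mx rmorphN /=.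
    by rewrite -[in RHS](natr_Zp r).
have /pcongP[g' Eg] := ga.
have Eg2 : map_mx intr (SLval g) = 1%:M + (a%:R : 'Z_l) *: map_mx intr g'.
  by rewrite Eg map_mxD map_mx1 map_mxZ.
have [|h Qh Eh] := elem_normal_generation (Zp_stable_rank_one l_gt1) Pn
  (g' := map_mx intr g').
  by rewrite -Eg2 det_map_mx SLdet rmorph1.
rewrite -(mulVKg h g); apply: QM => //; apply: Ql; apply: pcong_map => //.
by rewrite SLvalM map_mxM Eg2 -Eh -map_mxM -SLvalM mulVg map_mx1.
Qed.

(** Commutators with elementary matrices carry one root subgroup to all the
    others; this uses three distinct indices. *)
Lemma normal_subgroup_root n (i0 j0 k0 : 'I_n) (a : int) (Q : SL n int -> Prop) :
    i0 != j0 -> j0 != k0 -> i0 != k0 -> normal_subgroup Q ->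
    (forall r, Q (elemSL i0 j0 (a * r))) ->
  forall i j r, i != j -> Q (elemSL i j (a * r)).
Proof.
move=> ij0 jk0 ik0 [_ QM QV QJ] Q0.
have Q_comm i j k r : i != j -> j != k -> i != k ->
    (Q (elemSL i j (a * r)) -> Q (elemSL i k (a * r))) /\
    (Q (elemSL j k (a * r)) -> Q (elemSL i k (a * r))).
  move=> ij jk ik; split=> Qr.
    have -> : elemSL i k (a * r) = (elemSL i j (a * r) *
        (elemSL j k 1 * (elemSL i j (a * r))^-1 * (elemSL j k 1)^-1))%g.
      apply: SLval_inj; rewrite -!elemSLN // !SLvalM !elemSLE //.
      by rewrite elem_mx_commutator // mulr1.
    by apply: QM => //; apply/QJ/QV.
  have -> : elemSL i k (a * r) = (elemSL i j 1 * elemSL j k (a * r)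
       * (elemSL i j 1)^-1 * (elemSL j k (a * r))^-1)%g.
    apply: SLval_inj; rewrite -!elemSLN // !SLvalM !elemSLE //.
    by rewrite -!mulmxA [X in _ *m X]mulmxA elem_mx_commutator // mul1r.
  by apply: QM; [exact: QJ | exact: QV].
have Qi0 k r : i0 != k -> Q (elemSL i0 k (a * r)).
  move=> ik; have [<-//|jk] := eqVneq j0 k.
  by apply: (Q_comm i0 j0 k r _ _ _).1.
have Qik i k r : i0 != i -> i0 != k -> i != k -> Q (elemSL i k (a * r)).
  move=> i0i i0k ik; apply: (Q_comm i i0 k r _ _ _).2 => //; last exact: Qi0.
  by rewrite eq_sym.
move=> i j r ij; have [ji0|ji0] := eqVneq i0 j; last first.
  have [<-|ii0] := eqVneq i0 i; first exact: Qi0.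
  exact: Qik.
have i0i : i0 != i by rewrite ji0 eq_sym.
have [k k_i0 k_i] : exists2 k, i0 != k & i != k.
  have [->|ij'] := eqVneq i j0; first by exists k0.
  by exists j0.
rewrite -ji0; apply: (Q_comm i k i0 r _ _ _).1; rewrite 1?(eq_sym k) //.
  by rewrite eq_sym.
exact: Qik.
Qed.

(** * Splitting off the algebraic factor *)

Lemma meval_affine (K : comNzRingType) N (p : {mpoly K[N]}) (c d : 'I_N -> K) :
  exists P : {poly K}, forall t, P.[t] = p.@[fun k => c k + t * d k].
Proof.
exists (\sum_(m <- msupp p) (p@_m)%:P * \prod_i ((c i)%:P + d i *: 'X) ^+ m i).
move=> t; rewrite mevalE horner_sum; apply: eq_bigr => m _.
rewrite hornerM hornerC horner_prod; congr (_ * _); apply: eq_bigr => i _.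
by rewrite horner_exp hornerD hornerC hornerZ hornerX mulrC.
Qed.

Lemma poly_eq0_multiples (K : numDomainType) (l : nat) (P : {poly K}) :
  (0 < l)%N -> (forall s : nat, P.[(l * s)%:R] = 0) -> P = 0.
Proof.
move=> l_gt0 P0; pose zeros : seq K := [seq (l * s)%:R | s <- iota 0 (size P)].
apply: (@roots_geq_poly_eq0 _ _ zeros).
- by apply/allP => _ /mapP[s _ ->]; apply/rootP.
- rewrite map_inj_uniq ?iota_uniq // => s t /eqP.
  by rewrite eqr_nat eqn_pmul2l // => /eqP.
- by rewrite size_map size_iota.
Qed.

Section GLAction.
Variables (K : fieldType) (V : vectType K).
Implicit Types (f g : GL V) (v : V).

Lemma GLendM f g v : GLend (f * g)%g v = GLend f (GLend g v).
Proof. exact: comp_lfunE. Qed.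

Lemma GLend1 v : GLend (1%g : GL V) v = v.
Proof. exact: id_lfunE. Qed.

Lemma GLendK f v : GLend f^-1%g (GLend f v) = v.
Proof. by rewrite -GLendM mulVg GLend1. Qed.

Lemma GLend_eq0 f v : (GLend f v == 0) = (v == 0).
Proof.
apply/eqP/eqP => [fv0|->]; last exact: linear0.
by rewrite -(GLendK f v) fv0 linear0.
Qed.

Lemma GL_ext f g : (forall v, GLend f v = GLend g v) -> f = g.
Proof. by move=> eq_fg; apply/val_inj/lfunP. Qed.

Lemma vect_form_eq (u v : V) : (forall f : 'Hom(V, K^o), f u = f v) -> u = v.
Proof.
move=> eq_uv; rewrite (coord_vbasis (memvf u)) (coord_vbasis (memvf v)).
apply: eq_bigr => i _; congr (_ *: _).
pose f : 'Hom(V, K^o) := linfun (coord (vbasis fullv) i : V -> K^o).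
by have := eq_uv f; rewrite !lfunE.
Qed.

End GLAction.

Section CommuteElementary.
Variables (K : numFieldType) (V : vectType K) (n : nat).
Variable psi : {multiplicative SL n K -> GL V}.
Hypothesis psi_alg : algebraic_rep psi.

Lemma matrix_coef_poly (i j : 'I_n) (f : 'Hom(V, K^o)) v : i != j ->
  exists P : {poly K}, forall t, P.[t] = f (GLend (psi (elemSL i j t)) v).
Proof.
move=> ij; have [p Ep] := psi_alg f v.
have [P EP] := meval_affine p (mxvec 1%:M 0) (mxvec (delta_mx i j) 0).
exists P => t; rewrite EP Ep elemSLE //; apply: meval_eq => k.
by rewrite /elem_mx linearD linearZ /= !mxE.
Qed.

(** Every matrix coefficient of [T psi(e_ij(t)) - psi(e_ij(t)) T] is a
    polynomial in [t]; having infinitely many zeros, it vanishes.  This is the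
    part of Borel density that the theorem needs. *)
Lemma commute_elem (l : nat) (T : GL V) (i j : 'I_n) : (0 < l)%N -> i != j ->
    (forall s : nat, commute T (psi (elemSL i j (l * s)%:R))) ->
  forall r, commute T (psi (elemSL i j r)).
Proof.
move=> l_gt0 ij Tl r; apply: GL_ext => v; rewrite !GLendM.
apply: vect_form_eq => f.
have [P EP] := matrix_coef_poly (f \o GLend T)%VF v ij.
have [Q EQ] := matrix_coef_poly f (GLend T v) ij.
rewrite -EQ -[LHS](comp_lfunE f (GLend T)) -EP.
suff -> : P = Q by [].
apply/eqP; rewrite -subr_eq0; apply/eqP/(poly_eq0_multiples l_gt0) => s.
by rewrite hornerD hornerN EP EQ comp_lfunE -!GLendM Tl subrr.
Qed.

End CommuteElementary.

Lemma SLmapM n (A B : comNzRingType) (f : {rmorphism A -> B}) (g h : SL n A) :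
  SLmap f (g * h)%g = (SLmap f g * SLmap f h)%g.
Proof. by apply: val_inj; rewrite /= map_mxM. Qed.

Lemma SLmap1 n (A B : comNzRingType) (f : {rmorphism A -> B}) :
  SLmap f (1%g : SL n A) = 1%g.
Proof. by apply: val_inj; rewrite /= map_mx1. Qed.

Lemma SLmap_elem n (A B : comNzRingType) (f : {rmorphism A -> B}) (i j : 'I_n) r :
  i != j -> SLmap f (elemSL i j r) = elemSL i j (f r).
Proof. by move=> ij; apply: val_inj; rewrite /= !elemSLE // map_elem_mx. Qed.

Section MultiplicativeGroups.
Variables (G H : groupType) (f : {multiplicative G -> H}).

Lemma multiplicative1 : f 1%g = 1%g.
Proof. by apply: (mulIg (f 1%g)); rewrite -gmulfM !mul1g. Qed.

Lemma multiplicativeV x : f x^-1%g = (f x)^-1%g.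
Proof. by apply/esym/mulg1_eq; rewrite -gmulfM mulgV multiplicative1. Qed.

End MultiplicativeGroups.

Section Untwist.
Variables (K : numFieldType) (V : vectType K) (n l : nat).
Variable phi : {multiplicative SL n int -> GL V}.
Variable psi : {multiplicative SL n K -> GL V}.
Hypothesis l_gt0 : (0 < l)%N.
Hypothesis psi_alg : algebraic_rep psi.
Hypothesis phi_psi : forall g : SL n int,
  principal_congruence l g -> phi g = psi (SLmap intr g).

Definition psiZ (g : SL n int) : GL V := psi (SLmap intr g).
(** The error of [psi] as an approximation of [phi]: trivial on the level [l]
    subgroup, where the two agree. *)
Definition untwist (g : SL n int) : GL V := ((psiZ g)^-1 * phi g)%g.

Lemma psiZM g h : psiZ (g * h)%g = (psiZ g * psiZ h)%g.
Proof. by rewrite /psiZ SLmapM gmulfM. Qed.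

Lemma psiZ1 : psiZ 1%g = 1%g.
Proof. by rewrite /psiZ SLmap1 multiplicative1. Qed.

Lemma psiZV g : psiZ g^-1%g = (psiZ g)^-1%g.
Proof. by apply/esym/mulg1_eq; rewrite -psiZM mulgV psiZ1. Qed.

(** The matrices [h] such that [psi h] commutes with every [T] commuting with
    the image of the level [l] subgroup form a normal subgroup, because the
    latter is normal; quantifying over all such [T] at once is what makes
    closure under conjugation work. *)
Lemma commute_congruence_all (T : GL V) :
    (forall g, principal_congruence l g -> commute T (psiZ g)) ->
  forall g, commute T (psiZ g).
Proof.
move=> Tl g; pose Q h := forall T : GL V,
  (forall g, principal_congruence l g -> commute T (psiZ g)) ->
  commute T (psiZ h).
suff: Q g by apply.
apply: (@pcong_generation n l 1 Q) => // [|i j r ij|h hl T' T'l|];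
  last 2 first.
- exact: T'l.
- exact: pcong_all.
- split=> [|x y Qx Qy|x Qx|h x Qx] T' T'l.
  + by rewrite psiZ1; apply: commute1.
  + by rewrite psiZM; apply: commuteM; [apply: Qx | apply: Qy].
  + by rewrite psiZV; apply/commuteV/Qx.
  + have /Qx : forall g, principal_congruence l g ->
        commute ((psiZ h)^-1 * T' * psiZ h)%g (psiZ g).
      move=> k kl; have := T'l _ (pcongJ h kl).
      rewrite /commute !psiZM psiZV => Th.
      have -> : ((psiZ h)^-1 * T' * psiZ h * psiZ k)%g =
        ((psiZ h)^-1 * (T' * (psiZ h * psiZ k * (psiZ h)^-1)) * psiZ h)%g.
        by rewrite !mulgA mulgVK.
      by rewrite Th !mulgA mulVg mul1g.
    rewrite /commute !psiZM psiZV => Tx.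
    have -> : (T' * (psiZ h * psiZ x * (psiZ h)^-1))%g =
       (psiZ h * ((psiZ h)^-1 * T' * psiZ h * psiZ x) * (psiZ h)^-1)%g.
      by rewrite !mulgA mulgV mul1g.
    by rewrite Tx !mulgA mulgK.
move=> T' T'l; rewrite /psiZ SLmap_elem //.
apply: (commute_elem psi_alg l_gt0) => // s.
have := T'l _ (pcong_elemSL l s%:Z ij).
by rewrite /psiZ SLmap_elem // -PoszM.
Qed.

(** For [k] of level [l], computing [phi (g k g^-1)] through [phi] and through
    [psi] shows that [psi(g)^-1 phi(g)] commutes with [psi k]. *)
Lemma untwist_psi_commute g h : commute (untwist g) (psiZ h).
Proof.
apply: commute_congruence_all => k kl; rewrite /commute /untwist.
have := phi_psi (pcongJ g kl).
rewrite -/(psiZ _) !gmulfM multiplicativeV !psiZM psiZV.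
rewrite (phi_psi kl) -/(psiZ k) => /(congr1 (fun x => (psiZ g)^-1 * x * phi g)%g).
by rewrite !mulgA !mulgVK mulVg mul1g.
Qed.

Lemma untwistM g h : untwist (g * h)%g = (untwist g * untwist h)%g.
Proof.
rewrite {1}/untwist psiZM invgM gmulfM.
have := commuteV (untwist_psi_commute g h); rewrite /commute {1 3}/untwist => E.
by rewrite [RHS]mulgA E /untwist !mulgA.
Qed.

Lemma untwist_eq1 g : phi g = psiZ g -> untwist g = 1%g.
Proof. by rewrite /untwist => ->; rewrite mulVg. Qed.

Lemma untwist1_eq g : untwist g = 1%g -> phi g = psiZ g.
Proof. by rewrite /untwist => /mulg1_eq; rewrite invgK. Qed.

Lemma phi_untwist g : phi g = (psiZ g * untwist g)%g.
Proof. by rewrite /untwist mulVKg. Qed.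

End Untwist.

(** * Characters of (Z/l)^m *)

Section CharacterDecomposition.
Variables (K : numFieldType) (V : vectType K) (l m : nat) (z : K).
Hypothesis l_gt1 : (1 < l)%N.
Hypothesis z_prim : l.-primitive_root z.
Local Notation N := 'rV['Z_l]_m.

Definition Zp_exp (a : 'Z_l) : K := z ^+ a.

Lemma Zp_expD a b : Zp_exp (a + b) = Zp_exp a * Zp_exp b.
Proof.
rewrite /Zp_exp -exprD -(prim_expr_mod z_prim) -[RHS](prim_expr_mod z_prim).
have modE i : i %% (Zp_trunc l).+2 = i %[mod l] by rewrite Zp_cast // modn_mod.
by congr (_ ^+ _); apply: modE.
Qed.

Lemma Zp_exp_eq1 a : (Zp_exp a == 1) = (a == 0).
Proof.
rewrite -(prim_order_dvd z_prim) -val_eqE /=.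
have lt_al : (a < l)%N by rewrite -[l in (_ < l)%N](Zp_cast l_gt1).
by rewrite /dvdn modn_small.
Qed.

(** Characters of the row space over Z/l are indexed by the row space itself,
    through the standard pairing and the choice of the root of unity [z]. *)
Definition chi (c t : N) : K := Zp_exp ((c *m t^T) 0 0).

Lemma chiDl c d t : chi (c + d) t = chi c t * chi d t.
Proof. by rewrite /chi mulmxDl mxE Zp_expD. Qed.

Lemma chiDr c s t : chi c (s + t) = chi c s * chi c t.
Proof. by rewrite /chi linearD mulmxDr mxE Zp_expD. Qed.

Lemma chi0r c : chi c 0 = 1.
Proof. by rewrite /chi trmx0 mulmx0 mxE. Qed.

Lemma chiNl c t : chi (- c) t = chi c (- t).
Proof. by rewrite /chi linearN /= mulmxN mulNmx. Qed.

Lemma chiNr c t : chi c (- t) * chi c t = 1.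
Proof. by rewrite -chiDr addNr chi0r. Qed.

(** Orthogonality: multiplying the sum by [chi c (delta_mx 0 j)] permutes its
    terms, and this factor is not 1 when [c 0 j] is not 0. *)
Lemma chi_sum c : \sum_t chi c t = (#|{: N}| * (c == 0))%:R.
Proof.
have [->|c_neq0] := eqVneq c 0.
  rewrite muln1 -sum1_card natr_sum; apply: eq_bigr => t _.
  by rewrite /chi mul0mx mxE.
have [j cj] : exists j, c 0 j != 0.
  apply/existsP; apply: contraNT c_neq0 => /existsPn c0.
  by apply/eqP/rowP => j; rewrite mxE; apply/eqP; have := c0 j; rewrite negbK.
have chi1 : chi c (delta_mx 0 j) != 1.
  rewrite /chi trmx_delta -colE mxE.
  by rewrite Zp_exp_eq1.
rewrite muln0; apply/eqP; have : (chi c (delta_mx 0 j) - 1) * \sum_t chi c t == 0.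
  rewrite mulrBl mul1r mulr_sumr subr_eq0.
  rewrite [X in _ == X](reindex_inj (addrI (delta_mx 0 j))).
  by apply/eqP/eq_bigr => t _; rewrite chiDr.
by rewrite mulf_eq0 subr_eq0 (negPf chi1).
Qed.

Variable y : N -> GL V.
Hypothesis yD : forall s t, y (s + t) = (y s * y t)%g.

Lemma y0 : y 0 = 1%g.
Proof. by apply: (mulIg (y 0)); rewrite -yD addr0 mul1g. Qed.

Definition eigenchar c v := forall t, GLend (y t) v = chi c t *: v.

(** The projector to the [c]-eigenspace, up to the order of the group. *)
Definition char_proj c v := \sum_t chi c (- t) *: GLend (y t) v.

Lemma char_proj_eigen c v : eigenchar c (char_proj c v).
Proof.
move=> s; rewrite /char_proj linear_sum scaler_sumr /=.
rewrite [RHS](reindex_inj (addrI s)) /=; apply: eq_bigr => t _.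
rewrite linearZ /= yD GLendM scalerA opprD chiDr mulrA.
by rewrite [chi c s * _]mulrC chiNr mul1r.
Qed.

Lemma char_proj_sum v : \sum_c char_proj c v = #|{: N}|%:R *: v.
Proof.
rewrite /char_proj exchange_big /=.
have chi_sumr (t : N) : \sum_c chi c (- t) = (#|{: N}| * (t == 0))%:R.
  rewrite -chi_sum (reindex_inj (@oppr_inj _)); apply: eq_bigr => c _.
  by rewrite chiNl opprK /chi -[c *m _]trmxK trmx_mul trmxK mxE.
under eq_bigr do rewrite -scaler_suml chi_sumr.
rewrite (bigD1 0) //= eqxx muln1 y0 GLend1 big1 ?addr0 // => t /negPf ->.
by rewrite muln0 scale0r.
Qed.

Lemma char_projD c a u v :
  char_proj c (a *: u + v) = a *: char_proj c u + char_proj c v.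
Proof.
rewrite /char_proj scaler_sumr -big_split; apply: eq_bigr => t _ /=.
by rewrite linearP scalerDr !scalerA mulrC.
Qed.

Lemma char_proj_sumZ c I (r : seq I) (k : I -> K) (v : I -> V) :
  char_proj c (\sum_(i <- r) k i *: v i) =
    \sum_(i <- r) k i *: char_proj c (v i).
Proof.
elim: r => [|i r IHr]; last by rewrite !big_cons char_projD IHr.
by rewrite !big_nil /char_proj big1 // => t _; rewrite linear0 scaler0.
Qed.

Lemma char_proj_eigenchar c d v : eigenchar d v ->
  char_proj c v = (#|{: N}| * (c == d))%:R *: v.
Proof.
move=> dv; rewrite /char_proj; under eq_bigr do rewrite dv scalerA -chiNl -chiDl.
by rewrite -scaler_suml chi_sum addrC subr_eq0 eq_sym.
Qed.

Lemma cardN_neq0 : #|{: N}|%:R != 0 :> K.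
Proof. by rewrite pnatr_eq0 -lt0n; apply/card_gt0P; exists 0. Qed.

(** The eigenvectors [char_proj c v] add up to a nonzero multiple of [v], so
    [A] cannot vanish on all of them. *)
Lemma exists_eigenchar (A : V -> V) v :
    (forall u w, A (u + w) = A u + A w) -> (forall a u, A (a *: u) = a *: A u) ->
    A v != 0 -> exists c w, eigenchar c w /\ A w != 0.
Proof.
move=> AD AZ Av.
have [/existsP[c Ac]|/existsPn A0] := boolP [exists c, A (char_proj c v) != 0].
  by exists c, (char_proj c v); split; first exact: char_proj_eigen.
case/negP: Av; have : A (#|{: N}|%:R *: v) = 0.
  have A_0 : A 0 = 0 by rewrite -(scale0r v) AZ !scale0r.
  rewrite -char_proj_sum (big_morph A AD A_0) big1 // => c _.
  by apply/eqP; have := A0 c; rewrite negbK.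
by move/eqP; rewrite AZ scaler_eq0 (negPf cardN_neq0).
Qed.

(** Eigenvectors for distinct characters are independent: [char_proj] isolates
    each term of a linear relation. *)
Lemma eigenchar_card_le_dim (S : {set N}) :
    (forall c, c \in S -> exists2 v, v != 0 & eigenchar c v) ->
  (#|S| <= \dim {:V})%N.
Proof.
move=> Sv; have /fin_all_exists[v vP] : forall c, exists v : V,
    c \in S -> v != 0 /\ eigenchar c v.
  move=> c; have [/Sv[v v0 cv]|_] := boolP (c \in S); first by exists v.
  by exists 0.
pose X := [tuple v (enum_val i) | i < #|S|].
have XE (i : 'I_#|S|) : X`_i = v (enum_val i) by rewrite -tnth_nth tnth_mktuple.
have/eqP freeX : free X.
  apply/freeP => k kX j; have [vj_neq0 vj] := vP _ (enum_valP j).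
  have : char_proj (enum_val j) (\sum_(i < #|S|) k i *: X`_i) = 0.
    by rewrite kX /char_proj big1 // => t _; rewrite linear0 scaler0.
  rewrite char_proj_sumZ (bigD1 j) //= big1 ?addr0 => [|i ij]; last first.
    have [_ vi] := vP _ (enum_valP i).
    rewrite XE (char_proj_eigenchar _ vi).
    by rewrite (inj_eq enum_val_inj) eq_sym (negPf ij) muln0 scale0r scaler0.
  rewrite XE (char_proj_eigenchar _ vj) eqxx muln1 => /eqP.
  by rewrite !scaler_eq0 (negPf cardN_neq0) (negPf vj_neq0) !orbF => /eqP.
by rewrite -(size_tuple X) -freeX dimvS ?subvf.
Qed.

End CharacterDecomposition.

Lemma exists_prim_root (K : numClosedFieldType) n : (0 < n)%N ->
  exists z : K, n.-primitive_root z.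
Proof.
move=> n_gt0; pose p : {poly K} := 'X^n - 1.
have [r Dp] := closed_field_poly_normal p.
move: Dp; rewrite (monicP _) ?monicXnsubC // scale1r => Dp.
have rn1 : all n.-unity_root r by apply/allP => z; rewrite -root_prod_XsubC -Dp.
have sz_r : (n < (size r).+1)%N.
  by rewrite -(size_prod_XsubC r id) -Dp size_XnsubC.
have [|z] := hasP (has_prim_root n_gt0 rn1 _ sz_r); last by exists z.
by rewrite -separable_prod_XsubC -Dp separable_Xn_sub_1 // pnatr_eq0 -lt0n.
Qed.

(** * Representations of SL_n(Z) of level l *)

(** The Chinese remainder theorem for SL_n: the products of an element of
    level [a] and one of level [b] form a normal subgroup containing the level
    [a b] subgroup and, by Bezout, all elementary matrices. *)
Lemma pcong_coprime_decomposition n a b (g : SL n int) :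
    (0 < a)%N -> (0 < b)%N -> coprime a b ->
  exists g1 g2, [/\ principal_congruence a g1, principal_congruence b g2 &
                    g = (g1 * g2)%g].
Proof.
move=> a_gt0 b_gt0 co_ab.
pose Q (g : SL n int) := exists g1 g2, [/\ principal_congruence a g1,
  principal_congruence b g2 & g = (g1 * g2)%g].
apply: (@pcong_generation n (a * b) 1 Q); last exact: pcong_all.
- by rewrite muln_gt0 a_gt0.
- split.
  + by exists 1%g, 1%g; rewrite mulg1; split=> //; apply: pcong1.
  + move=> _ _ [g1 [g2 [ag1 bg2 ->]]] [h1 [h2 [ah1 bh2 ->]]].
    exists (g1 * (g2 * h1 * g2^-1))%g, (g2 * h2)%g; split.
    * exact/pcongM/pcongJ.
    * exact: pcongM.
    * by rewrite !mulgA mulgVK.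
  + move=> _ [g1 [g2 [ag1 bg2 ->]]]; exists g1^-1%g, (g1 * g2^-1 * g1^-1)%g.
    split; [exact: pcongV | exact/pcongJ/pcongV |].
    by rewrite invgM !mulgA mulVg mul1g.
  + move=> h _ [g1 [g2 [ag1 bg2 ->]]].
    exists (h * g1 * h^-1)%g, (h * g2 * h^-1)%g.
    by split; [exact: pcongJ | exact: pcongJ | rewrite !mulgA mulgVK].
- move=> i j r ij; have /eqP co := co_ab.
  have [u [v uv]] : exists u v : int, u * a%:Z + v * b%:Z = 1.
    have := Bezoutz a%:Z b%:Z.
    by case=> u [v]; rewrite /gcdz /= co => uv; exists u, v.
  exists (elemSL i j (a%:Z * (u * r%:Z))), (elemSL i j (b%:Z * (v * r%:Z))).
  split; [exact: pcong_elemSL | exact: pcong_elemSL | rewrite -elemSLD //].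
  by congr (elemSL i j _); rewrite mul1r -[LHS]mul1r -uv; ring.
- move=> h hab; exists h, 1%g; rewrite mulg1.
  by split=> //; [apply: pcong_dvd hab; apply: dvdn_mulr | apply: pcong1].
Qed.

Lemma dvdn_div_mull (l p b : nat) :
  (p %| l)%N -> (p %| b)%N -> (l %| l %/ p * b)%N.
Proof.
by move=> pl /dvdnP[c ->]; rewrite mulnCA mulnA -mulnA divnK // dvdn_mull.
Qed.

Lemma prime_dvdn_partC (l p q : nat) :
  prime p -> prime q -> (q %| l)%N -> q != p -> (0 < l)%N -> (q %| l`_(p^'))%N.
Proof.
move=> p_pr q_pr q_l qp l_gt0; rewrite -(@Gauss_dvdr _ l`_p) ?partnC //.
rewrite prime_coprime // p_part; apply: contra qp.
by rewrite Euclid_dvdX // dvdn_prime2 // => /andP[].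
Qed.

Section LevelRepresentation.
Variables (K : numFieldType) (V : vectType K) (k l : nat) (z : K).
Local Notation m := (1 + k.+1)%N.
Local Notation n := (1 + m)%N.
Hypothesis l_gt1 : (1 < l)%N.
Hypothesis z_prim : l.-primitive_root z.
Variable sg : SL n int -> GL V.
Hypothesis sgM : forall g h, sg (g * h)%g = (sg g * sg h)%g.
Hypothesis sg_level : forall g, principal_congruence l g -> sg g = 1%g.
Hypothesis sg_fixed : forall p v, prime p -> (p %| l)%N ->
  (forall g, principal_congruence (l %/ p) g -> GLend (sg g) v = v) -> v = 0.

Let l_gt0 : (0 < l)%N := ltnW l_gt1.

Lemma sg1 : sg 1%g = 1%g.
Proof. exact/sg_level/pcong1. Qed.

Lemma sgV g : sg g^-1%g = (sg g)^-1%g.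
Proof. by apply/esym/mulg1_eq; rewrite -sgM mulgV sg1. Qed.

Lemma sg_mod g h : map_mx intr (SLval g) = map_mx intr (SLval h) :> 'M['Z_l]_n ->
  sg g = sg h.
Proof.
move=> Egh; apply: divg1_eq; rewrite -sgV -sgM; apply/sg_level/pcong_map => //.
by rewrite SLvalM map_mxM Egh -map_mxM -SLvalM mulgV map_mx1.
Qed.

(** By [pcong_commute], congruence subgroups whose levels multiply to a
    multiple of [l] have commuting images. *)
Lemma sg_commute a b g h : (l %| a * b)%N ->
  principal_congruence a g -> principal_congruence b h -> commute (sg g) (sg h).
Proof.
move=> l_ab ag bh; have := sg_level (pcong_commute l_ab ag bh).
by rewrite sgM sgV !sgM => /divg1_eq.
Qed.

Definition Zp_lift (a : 'Z_l) : int := (a : nat)%:Z.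

Lemma Zp_liftK a : (Zp_lift a)%:~R = a :> 'Z_l.
Proof. exact: natr_Zp. Qed.

Lemma map_Zp_lift p q (M : 'M['Z_l]_(p, q)) :
  map_mx intr (map_mx Zp_lift M) = M.
Proof. by apply/matrixP => i j; rewrite !mxE Zp_liftK. Qed.

(** The abelian group of matrices that differ from 1 in the first row acts
    through (Z/l)^m, since [sg] has level [l]. *)
Definition root_row (t : 'rV['Z_l]_m) : GL V :=
  sg (toSL (upper_row (map_mx Zp_lift t))).

Lemma map_root_row (t : 'rV['Z_l]_m) :
  map_mx intr (SLval (toSL (upper_row (map_mx Zp_lift t)))) = upper_row t.
Proof.
rewrite toSLE ?det_upper_row //.
by rewrite /upper_row map_block_mx !map_mx1 map_mx0 map_Zp_lift.
Qed.

Lemma root_rowE (g : SL n int) (t : 'rV['Z_l]_m) :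
  map_mx intr (SLval g) = upper_row t -> sg g = root_row t.
Proof. by move=> Eg; apply: sg_mod; rewrite map_root_row. Qed.

Lemma root_rowD s t : root_row (s + t) = (root_row s * root_row t)%g.
Proof.
rewrite -sgM; apply/esym/root_rowE.
by rewrite SLvalM map_mxM !map_root_row upper_rowD.
Qed.

Lemma root_row_conj (H : SL n int) (d : 'M['Z_l]_m) t :
    map_mx intr (SLval H) = lower_block d ->
  (root_row t * sg H = sg H * root_row (t *m d))%g.
Proof.
move=> EH; have detd : \det d = 1.
  by rewrite -det_lower_block -EH det_map_mx SLdet rmorph1.
apply: (mulIg (sg H)^-1%g); rewrite mulgK -sgV -!sgM; apply/esym/root_rowE.
rewrite !SLvalM !map_mxM EH map_root_row.
have -> : map_mx intr (SLval H^-1%g) = lower_block (\adj d).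
  have de : lower_block d *m lower_block (\adj d) = 1%:M.
    by rewrite lower_blockM mul_mx_adj detd lower_block1.
  rewrite -[LHS]mulmx1 -de mulmxA -EH -map_mxM -SLvalM mulVg SLval1.
  by rewrite map_mx1 mul1mx.
by apply: upper_row_conj; rewrite mul_mx_adj detd.
Qed.

Local Notation eigen := (eigenchar z root_row).
Definition occurs c := exists2 v, v != 0 & eigen c v.

Lemma occurs_conj (H : SL n int) (d : 'M['Z_l]_m) c :
  map_mx intr (SLval H) = lower_block d -> occurs c -> occurs (c *m d^T).
Proof.
move=> EH [v v_neq0 cv]; exists (GLend (sg H) v); first by rewrite GLend_eq0.
move=> t; rewrite -GLendM (root_row_conj t EH) GLendM cv linearZ /=.
by congr (_ *: _); rewrite /chi trmx_mul mulmxA.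
Qed.

(** Column operations coming from SL_m move the character [row_mx u b]: this
    lemma and the next one are the two block transvections. *)
Lemma occurs_shift_right (u : 'M_1) (b s : 'rV_k.+1) :
  occurs (row_mx u b) -> occurs (row_mx u (u *m s + b)).
Proof.
pose c := lower_col (map_mx Zp_lift s^T) : 'M_m.
have detc : \det (lower_block c) = 1.
  by rewrite det_lower_block det_lblock !det1 mulr1.
move/(@occurs_conj (toSL (lower_block c)) (lower_col s^T)).
rewrite /lower_col tr_block_mx !trmx1 trmx0 trmxK mul_row_block.
rewrite !(mulmx1, mulmx0, addr0); apply.
rewrite toSLE // /lower_block /c /lower_col.
by rewrite !map_block_mx !map_mx1 !map_mx0 map_Zp_lift.
Qed.

Lemma occurs_shift_left (u : 'M_1) (b : 'rV_k.+1) (s : 'cV_k.+1) :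
  occurs (row_mx u b) -> occurs (row_mx (u + b *m s) b).
Proof.
pose c := upper_row (map_mx Zp_lift s^T) : 'M_m.
have detc : \det (lower_block c) = 1 by rewrite det_lower_block det_upper_row.
move/(@occurs_conj (toSL (lower_block c)) (upper_row s^T)).
rewrite /upper_row tr_block_mx !trmx1 trmx0 trmxK mul_row_block.
rewrite !(mulmx1, mulmx0, add0r); apply.
rewrite toSLE // /lower_block /c /upper_row.
by rewrite !map_block_mx !map_mx1 !map_mx0 map_Zp_lift.
Qed.

(** An invertible first coordinate lets the others be chosen freely; choosing
    one of them equal to 1 then lets the first coordinate be changed. *)
Lemma occurs_unit_orbit (u v : 'Z_l) (b c : 'rV_k.+1) :
    u \is a GRing.unit -> v \is a GRing.unit ->
  occurs (row_mx u%:M b) -> occurs (row_mx v%:M c).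
Proof.
move=> Uu Uv; pose e : 'rV['Z_l]_k.+1 := delta_mx 0 0.
have move_b (w : 'Z_l) (b1 b2 : 'rV_k.+1) : w \is a GRing.unit ->
    occurs (row_mx w%:M b1) -> occurs (row_mx w%:M b2).
  move=> Uw /(@occurs_shift_right _ _ (w^-1 *: (b2 - b1))).
  by rewrite mul_scalar_mx scalerA divrr // scale1r subrK.
move/(move_b u b e Uu)/(@occurs_shift_left _ _ ((v - u) *: e^T)).
have -> : u%:M + e *m ((v - u) *: e^T) = v%:M.
  rewrite -scalemxAr trmx_delta mul_delta_mx.
  rewrite [delta_mx 0 0]mx11_scalar mxE scale_scalar_mx mulr1 -raddfD.
  by rewrite addrC subrK.
exact: move_b.
Qed.

Definition e0 : 'rV['Z_l]_m := delta_mx 0 (lshift _ 0).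
Definition rootX (r : nat) : GL V := root_row (r%:R *: e0).
(** The product over [p] in [s] of the operators [1 - X^(l/p)], where [X] is
    the image of an elementary matrix.  When the [p] in [s] are primes dividing
    [l], it acts on an eigenvector of [X] with eigenvalue [z ^ a] by a scalar
    that is nonzero exactly when none of them divides [a]. *)
Definition primitive_part (s : seq nat) (v : V) : V :=
  foldr (fun p w => w - GLend (rootX (l %/ p)) w) v s.

Let i0 : 'I_n := lshift m 0.
Let j0 : 'I_n := rshift 1 (lshift k.+1 0).
Let k0 : 'I_n := rshift 1 (rshift 1 0).

Lemma sg_elem (r : nat) : sg (elemSL i0 j0 r%:Z) = rootX r.
Proof.
by apply: root_rowE; rewrite elemSLE // map_elem_mx upper_row_delta.
Qed.

Lemma primitive_partD s u v :
  primitive_part s (u + v) = primitive_part s u + primitive_part s v.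
Proof. by elim: s => //= p s ->; rewrite linearD opprD addrACA. Qed.

Lemma primitive_partZ s a v :
  primitive_part s (a *: v) = a *: primitive_part s v.
Proof. by elim: s => //= p s ->; rewrite linearZ scalerBr. Qed.

Lemma primitive_part_commute s b g v :
    (forall p, p \in s -> l %| l %/ p * b)%N -> principal_congruence b g ->
  GLend (sg g) (primitive_part s v) = primitive_part s (GLend (sg g) v).
Proof.
move=> + bg; elim: s => //= p s IHs sb; rewrite linearB /= -IHs; last first.
  by move=> q qs; apply: sb; rewrite in_cons qs orbT.
congr (_ - _); rewrite -!GLendM -sg_elem.
rewrite (@sg_commute (l %/ p) b (elemSL i0 j0 (l %/ p)%:Z) g) //.
  by apply: sb; rewrite mem_head.
by rewrite -[_%:Z]mulr1; apply: pcong_elemSL.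
Qed.

(** Add the primes one by one.  If [1 - X^(l/p)] killed the image of the
    operator [A] built so far, then [sg g A = A] for [g = e_01(l/p)].  Write
    [l = a b] with [b] the [p]-part of [l].  Every matrix is a product of one
    of level [a], whose image commutes with [A], and one of level [b], whose
    image commutes with [sg g].  So [sg h A = A] for all conjugates [h] of [g],
    hence on the level [l/p] subgroup, which would fix the image of [A]. *)
Lemma primitive_part_neq0 s : uniq s -> {subset s <= primes l} ->
  (exists v : V, v != 0) -> exists v, primitive_part s v != 0.
Proof.
move=> us sl [v0 v0_neq0]; elim: s us sl => [|p s IHs] /=; first by exists v0.
case/andP=> ps us sl.
have [q qs|v Av_neq0] := IHs us; first by apply: sl; rewrite in_cons qs orbT.
have /and3P[p_pr _ p_l] : [&& prime p, (0 < l)%N & (p %| l)%N].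
  by rewrite -mem_primes sl ?mem_head.
pose a := (l`_(p^'))%N; pose b := (l`_p)%N.
have p_b : (p %| b)%N.
  by rewrite /b p_part -{1}(expn1 p) dvdn_exp2l // logn_gt0 sl ?mem_head.
have A_comm g u : principal_congruence a g ->
    GLend (sg g) (primitive_part s u) = primitive_part s (GLend (sg g) u).
  apply: primitive_part_commute => q qs.
  have /and3P[q_pr _ q_l] : [&& prime q, (0 < l)%N & (q %| l)%N].
    by rewrite -mem_primes sl ?in_cons ?qs ?orbT.
  apply: dvdn_div_mull => //; apply: prime_dvdn_partC => //.
  by apply: contraNneq ps => <-.
apply/not_existsP => Ap0; case/eqP: Av_neq0; apply: (sg_fixed p_pr p_l) => g gp.
have rootX_fix u :
    GLend (rootX (l %/ p)) (primitive_part s u) = primitive_part s u.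
  by have /negP := Ap0 u; rewrite negbK subr_eq0 => /eqP.
pose Q g := principal_congruence (l %/ p) g /\
  forall u, GLend (sg g) (primitive_part s u) = primitive_part s u.
suff: Q g by case.
have Qn : normal_subgroup Q.
  split=> [|x y [px Qx] [py Qy]|x [px Qx]|h x [px Qx]].
  - by split=> [|u]; [exact: pcong1 | rewrite sg1 GLend1].
  - by split=> [|u]; [exact: pcongM | rewrite sgM GLendM Qy Qx].
  - by split=> [|u]; [exact: pcongV | rewrite sgV -{1}(Qx u) GLendK].
  split=> [|u]; first exact: pcongJ.
  have [h1 [h2 [ah1 bh2 ->]]] : exists h1 h2, [/\ principal_congruence a h1,
      principal_congruence b h2 & h = (h1 * h2)%g].
    apply: pcong_coprime_decomposition; rewrite ?part_gt0 //.
    by rewrite coprime_sym coprime_partC.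
  have := sg_commute (dvdn_div_mull p_l p_b) px bh2; rewrite /commute => Exh2.
  rewrite !sgM sgV sgM invgM !mulgA -[(_ * _ * sg x)%g]mulgA -Exh2 !mulgA mulgK.
  rewrite -sgV !GLendM A_comm ?Qx -?A_comm; [|exact: pcongV..].
  by rewrite -GLendM -sgM mulgV sg1 GLend1.
apply: (pcong_generation l_gt0 Qn _ _ gp) => [i j r ij|h hl]; last first.
  split=> [|u]; last by rewrite sg_level // GLend1.
  by apply: pcong_dvd hl; apply: dvdn_div.
apply: (@normal_subgroup_root _ i0 j0 k0 _ Q) => // t.
have Qnat (r' : nat) : Q (elemSL i0 j0 ((l %/ p)%:Z * r'%:Z)).
  split=> [|u]; first exact: pcong_elemSL.
  elim: r' => [|r' IHr].
    by rewrite mulr0 (sg_elem 0) /rootX scale0r (y0 root_rowD) GLend1.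
  rewrite -(addn1 r') PoszD mulrDr mulr1 elemSLD // sgM GLendM sg_elem rootX_fix.
  exact: IHr.
case: t => r'; first exact: Qnat.
rewrite NegzE mulrN elemSLN //; case: Qn => _ _ QV _; exact/QV/Qnat.
Qed.

Lemma chi_e0 c r : chi z c (r%:R *: e0) = Zp_exp z (c 0 (lshift _ 0) * r%:R).
Proof.
by rewrite /chi linearZ /= -scalemxAr mxE /e0 trmx_delta -colE mxE mulrC.
Qed.

(** On a [c]-eigenvector, [primitive_part] multiplies by the product of the
    [1 - z ^ (c_0 l/p)]; when this is not 0, no prime of [l] divides the first
    coordinate [c_0]. *)
Lemma occurs_unit : (exists v : V, v != 0) ->
  exists u (b : 'rV_k.+1), u \is a GRing.unit /\ occurs (row_mx u%:M b).
Proof.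
move=> V_neq0.
have [v Av] := primitive_part_neq0 (primes_uniq l) (fun _ => id) V_neq0.
have [c [w [cw Aw]]] := exists_eigenchar l_gt1 z_prim root_rowD
  (primitive_partD (primes l)) (primitive_partZ (primes l)) Av.
have w_neq0 : w != 0.
  apply: contraNneq Aw => ->; rewrite -[X in primitive_part _ X](scale0r v).
  by rewrite primitive_partZ scale0r.
pose u := c 0 (lshift k.+1 0); exists u, (rsubmx c); split; last first.
  exists w => //; suff -> : row_mx u%:M (rsubmx c) = c by [].
  rewrite -[RHS]hsubmxK; congr row_mx; rewrite [RHS]mx11_scalar.
  by rewrite mxE.
have AE s : primitive_part s w =
    \prod_(p <- s) (1 - chi z c ((l %/ p)%:R *: e0)) *: w.
  elim: s => [|p s IHs] /=; first by rewrite big_nil scale1r.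
  rewrite IHs linearZ /= /rootX cw big_cons !scalerA -scalerBl mulrBl mul1r.
  by rewrite mulrC.
rewrite -[u]natr_Zp unitZpE //; apply: coprime_from_primes => // p p_pr p_l.
apply/negP => /dvdnP[q uq].
have u0 : u * (l %/ p)%:R = 0.
  apply/eqP; rewrite -[u]natr_Zp uq -natrM -mulnA [(p * _)%N]mulnC divnK //.
  by rewrite -val_eqE /= val_Zp_nat // modnMl.
move: Aw; rewrite AE (big_rem p) ?mem_primes ?p_pr ?l_gt0 //= chi_e0 -/u u0.
by rewrite subrr mul0r scale0r eqxx.
Qed.

(** All the characters [row_mx u b] with [u] a unit occur, and there are
    [totient l * l ^ k.+1] of them. *)
Theorem level_rep_dim_ge :
  (exists v : V, v != 0) -> (totient l * l ^ k.+1 <= \dim {:V})%N.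
Proof.
move=> V_neq0; have [u [b [Uu occ_u]]] := occurs_unit V_neq0.
pose f (x : 'Z_l * 'rV['Z_l]_k.+1) : 'rV['Z_l]_m := row_mx x.1%:M x.2.
pose S := setX [set v : 'Z_l | v \is a GRing.unit] [set: 'rV['Z_l]_k.+1].
have f_inj : injective f.
  move=> [x s] [y t] /eq_row_mx[/matrixP/(_ 0 0)]; rewrite !mxE /= !mulr1n.
  by move=> -> ->.
have <- : #|f @: S| = (totient l * l ^ k.+1)%N.
  rewrite card_imset // cardsX cardsT card_mx mul1n card_ord.
  rewrite [in X in (_ * X)%N]Zp_cast //.
  congr (_ * _)%N.
  rewrite -(card_units_Zp l_gt0) cardsT card_sub.
  by apply: eq_card => x; rewrite !inE.
apply: (eigenchar_card_le_dim l_gt1 z_prim (y := root_row)) => r.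
case/imsetP=> -[v c] /setXP[Uv _] ->.
by rewrite inE in Uv; apply: occurs_unit_orbit Uu Uv occ_u.
Qed.

End LevelRepresentation.

(** * Representations of depth l *)

(** A subspace of largest dimension among those on which [P] holds. *)
Lemma vspace_of_predicate (K : fieldType) (V : vectType K) (P : V -> Prop) :
    P 0 -> (forall a u v, P u -> P v -> P (a *: u + v)) ->
  exists U : {vspace V}, forall v, v \in U <-> P v.
Proof.
move=> P0 PD.
have grow d : (exists U : {vspace V}, forall v, v \in U <-> P v) \/
    exists U : {vspace V}, (d <= \dim U)%N /\ forall v, v \in U -> P v.
  elim: d => [|d [exU|[U [dU UP]]]]; [|by left|].
    by right; exists 0%VS; split=> // v; rewrite memv0 => /eqP ->.
  have [[v [Pv vU]]|PU] := EM (exists v, P v /\ v \notin U); last first.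
    left; exists U => v; split=> [/UP//|Pv].
    by apply: contrapT => /negP vU; apply: PU; exists v.
  right; exists (U + <[v]>)%VS.
  split=> [|_ /memv_addP[u uU [_ /vlineP[a ->] ->]]].
    rewrite dimv_disjoint_sum; last first.
      apply/eqP; rewrite -subv0; apply/subvP => x; rewrite memv_cap => /andP[xU].
      case/vlineP=> a xa; rewrite memv0; apply: contraNT vU => x0.
      have a0 : a != 0 by apply: contraNneq x0 => a0; rewrite xa a0 scale0r.
      by rewrite -[v](scalerK a0) -xa memvZ.
    have v0 : v != 0 by apply: contraNneq vU => ->; apply: mem0v.
    by rewrite dim_vline v0 addn1 ltnS.
  by rewrite addrC; apply: PD => //; apply: UP.
have [//|[U [dU _]]] := grow (\dim {:V}).+1.
by have := leq_trans dU (dimvS (subvf U)); rewrite ltnn.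
Qed.

Lemma natr_totient l : (0 < l)%N ->
  l%:R * \prod_(p <- primes l) (1 - p%:R^-1) = (totient l)%:R :> rat.
Proof.
move=> l_gt0; rewrite totientE // {1}(prod_prime_decomp l_gt0).
rewrite prime_decompE big_map /= !natr_prod -big_split /=.
rewrite !big_seq; apply: eq_bigr => p; rewrite mem_primes => /and3P[p_pr _ p_l].
have p_gt0 := prime_gt0 p_pr.
have : (0 < logn p l)%N by rewrite logn_gt0 mem_primes p_pr l_gt0.
case: (logn p l) => // e _; rewrite expnS !natrM mulrAC mulrBr mulr1.
rewrite divff ?pnatr_eq0 -?lt0n //; congr (_ * _).
by rewrite -{1}(prednK p_gt0) -addn1 natrD addrK.
Qed.

Section Fixed.
Variables (K : numFieldType) (V : vectType K) (n l : nat).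
Variable phi : {multiplicative SL n int -> GL V}.
Variable psi : {multiplicative SL n K -> GL V}.
Hypothesis phi_irr : irreducible_rep phi.
Hypothesis phi_depth : has_depth phi l.
Hypothesis psi_alg : algebraic_rep psi.
Hypothesis phi_psi : forall g : SL n int,
  principal_congruence l g -> phi g = psi (SLmap intr g).

(** The vectors fixed by the level [l/p] subgroup form a [phi]-stable
    subspace, because that subgroup is normal and [untwist] commutes with
    [psi].  If they were the whole space, [phi] and [psi] would agree on the
    level [l/p] subgroup, and the depth would be at most [l/p]. *)
Lemma untwist_fixed p v : prime p -> (p %| l)%N ->
  (forall g, principal_congruence (l %/ p) g ->
     GLend (untwist phi psi g) v = v) ->
  v = 0.
Proof.
move=> p_pr p_l fix_v; have [l_gt0 _ l_min] := phi_depth.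
have sgM := untwistM l_gt0 psi_alg phi_psi.
have sgpsi := untwist_psi_commute l_gt0 psi_alg phi_psi.
pose W w := forall g, principal_congruence (l %/ p) g ->
  GLend (untwist phi psi g) w = w.
have [||U UW] := @vspace_of_predicate K V W.
- by move=> g _; rewrite linear0.
- by move=> a u w Wu Ww g gp; rewrite linearD linearZ /= (Wu g gp) (Ww g gp).
have Ustable g : (GLend (phi g) @: U <= U)%VS.
  apply/subvP => _ /memv_imgP[w /UW Ww ->]; apply/UW => h hp.
  rewrite (phi_untwist phi psi) GLendM -[LHS]GLendM (sgpsi h g) GLendM.
  congr (GLend _ _); rewrite -[LHS]GLendM -sgM.
  have -> : (h * g = g * (g^-1 * h * g^-1^-1))%g.
    by rewrite invgK !mulgA mulgV mul1g.
  rewrite sgM GLendM; congr (GLend _ _).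
  exact: Ww (pcongJ g^-1%g hp).
case: phi_irr => _ /(_ U Ustable)[U0|Uf].
  by apply/eqP; rewrite -memv0 -U0; apply/UW.
have := l_min (l %/ p)%N; rewrite divn_gt0 ?prime_gt0 // dvdn_leq //.
rewrite leqNgt ltn_Pdiv ?prime_gt1 // => /(_ isT) absurd_depth.
suff /absurd_depth : algebraic_on_congruence phi (l %/ p) by [].
exists psi; split=> // g gp; apply: untwist1_eq; apply: GL_ext => w.
by rewrite GLend1; apply: (UW w).1; rewrite // Uf memvf.
Qed.

End Fixed.

Theorem irreducible_depth_dim_ge (K : numClosedFieldType) (k : nat)
    (V : vectType K) (phi : {multiplicative SL k.+3 int -> GL V}) (l : nat) :
  irreducible_rep phi -> has_depth phi l ->
  (totient l * l ^ k.+1 <= \dim {:V})%N.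
Proof.
move=> irr hl; have [l_gt0 [psi [psi_alg phi_psi]] _] := hl.
have [dimV_gt0 _] := irr.
have [l_gt1|l_le1] := ltnP 1 l; last first.
  have -> : l = 1%N by apply/eqP; rewrite eqn_leq l_le1.
  by rewrite exp1n.
have [z z_prim] := @exists_prim_root K l l_gt0.
apply: (@level_rep_dim_ge K V k l z l_gt1 z_prim (untwist phi psi)).
- exact: untwistM l_gt0 psi_alg phi_psi.
- by move=> g /phi_psi; apply: untwist_eq1.
- by move=> p v; apply: untwist_fixed irr hl psi_alg phi_psi p v.
- by exists (vpick fullv); rewrite vpick0 -dimv_eq0 -lt0n.
Qed.

Theorem corollary2p8 (R : realType) (n : nat) (hn : (3 <= n)%N)
    (V : vectType R[i]) (phi : {multiplicative SL n int -> GL V}) (l : nat)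
    (irr : irreducible_rep phi) (hl : has_depth phi l) :
  l%:R ^+ (n - 1) * (\prod_(p <- primes l) (1 - p%:R^-1)) <=
    (\dim {:V})%:R :> rat /\
  l%:R ^+ (n - 2) <=
    l%:R ^+ (n - 1) * (\prod_(p <- primes l) (1 - p%:R^-1)) :> rat.
Proof.
case: n hn phi irr hl => [|[|[|k]]] // _ phi irr hl.
have [l_gt0 _ _] := hl.
have -> : l%:R ^+ (k.+3 - 1) * \prod_(p <- primes l) (1 - p%:R^-1) =
    (totient l * l ^ k.+1)%:R :> rat.
  by rewrite subn1 /= exprSr -mulrA natr_totient // mulrC natrM natrX.
rewrite -natrX !ler_nat; split; first exact: irreducible_depth_dim_ge irr hl.
by rewrite subn2 leq_pmull // totient_gt0.
Qed.
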